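(* Let $\mathcal T=(S,2^S,\kappa,\mathrm{AP},\mathcal L)$ be a labelled denumerable Markov chain with a finite attractor, let $\mathcal M=(Q,q_0,E,\mathcal F)$ be a deterministic Muller automaton over $\mathrm{AP}$, and let $B$ be a finite attractor for $\mathcal T\ltimes\mathcal M$. Then for every initial distribution $\mu\in\mathrm{Dist}(S)$ for $\mathcal T$: $$\mathrm{Prob}^{\mathcal T\ltimes\mathcal M}_{\mu\times\delta_{q_0}}(\mathrm{Inf}\in\mathcal F)=\sum_{C\in\mathrm{Good}^B_{\mathcal T\ltimes\mathcal M}(\mathcal F)}\mathrm{Prob}^{\mathcal T\ltimes\mathcal M}_{\mu\times\delta_{q_0}}(\mathbf F C).$$
   Context: A labelled denumerable Markov chain is $\mathcal T=(S,2^S,\kappa,\mathrm{AP},\mathcal L)$ with $S$ at most countable, $\kappa$ a Markov kernel on $S$, $\mathrm{AP}$ a finite set of atomic propositions and $\mathcal L:S\to2^{\mathrm{AP}}$. $\mathrm{Dist}(S)$ is the set of probability measures on $S$; $\mathrm{Prob}^{\mathcal T}_\mu$ is the law on $S^\omega$ of the Markov chain with initial distribution $\mu$ and kernel $\kappa$. $\mathbf F B$ is the event that $B$ is visited at some time $i\ge0$. A set $B$ is an attractor for $\mathcal T$ if $\mathrm{Prob}^{\mathcal T}_\mu(\mathbf F B)=1$ for every initial distribution $\mu$. A deterministic Muller automaton (DMA) over $\mathrm{AP}$ is $\mathcal M=(Q,q_0,E,\mathcal F)$ with $Q$ finite, $q_0\in Q$, $E\subseteq Q\times2^{\mathrm{AP}}\times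 Q$ such that for every $(q,u)$ there is exactly one $q'$ with $(q,u,q')\in E$, and $\mathcal F\subseteq2^Q$. The product $\mathcal T\ltimes\mathcal M$ is the labelled Markov chain with state space $S\times Q$, kernel $\kappa'((s,q),\{(s',q')\})=\kappa(s,\{s'\})$ if $(q,\mathcal L(s),q')\in E$ and $0$ otherwise, and labelling $(s,q)\mapsto q$. $\mathrm{Inf}\in\mathcal F$ is the event that the set of $q\in Q$ occurring infinitely often as second component along the path belongs to $\mathcal F$. (If $\mathcal T$ has a finite attractor $A$, then $A\times Q$ is a finite attractor of $\mathcal T\ltimes\mathcal M$.) $\mathrm{Graph}_{\mathcal T\ltimes\mathcal M}(B)$ is the finite directed graph with vertex set $B$ and an edge from $(s_1,q_1)$ to $(s_2,q_2)$ iff there is a path (finite sequence of positive-probability transitions) from $(s_1,q_1)$ to $(s_2,q_2)$ in $\mathcal T\ltimes\mathcal M$. A BSCC is a bottom strongly connected component of this graph (a strongly connected component that cannot be left). A BSCC $C$ is good for $\mathcal F$, written $C\in\mathrm{Good}^B_{\mathcal T\ltimes\mathcal M}(\mathcal F)$, if there is $F\in\mathcal F$ such that (a) for every $(s,q)\in S\times Q$ reachable by a path of $\mathcal T\ltimes\mathcal M$ from some $(r,p)\in C$, one has $q\in F$; and (b) for every $q\in F$ there are $s\in S$ and $(r,p)\in C$ with a path from $(r,p)$ to $(s,q)$ in $\mathcal T\ltimes\mathcal M$. *)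

(* Defs.v *)
From Stdlib Require Import Relation_Operators.
From HB Require Import structures.
From mathcomp Require Import all_boot all_order all_algebra.
From mathcomp Require Import all_classical all_reals all_analysis.
From mathcomp Require Import measurable_realfun.
From mathcomp Require Import ring lra.

Set Implicit Arguments.
Unset Strict Implicit.
Unset Printing Implicit Defensive.
Import Order.TTheory GRing.Theory Num.Theory.
Import numFieldNormedType.Exports.

Local Open Scope classical_set_scope.
Local Open Scope ring_scope.
Local Open Scope ereal_scope.

Definition countable_discrete d (S : measurableType d) : Prop :=
  countable [set: S] /\ forall A : set S, measurable A.

Definition coordinate_sets d (S : measurableType d) : set (set (nat -> S)) :=
  \bigcup_n preimage_set_system setT (fun rho : nat -> S => rho n) measurable.

(* S^omega, with the product sigma-algebra. *)
Notation infinite_path S := (g_sigma_algebraType (@coordinate_sets _ S)).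

(* Since S is countable and discrete, a measure on S^omega is determined by
   its values on cylinders (see [markov_law_unique]). *)
Definition is_markov_law d (S : measurableType d) (R : realType)
    (mu : probability S R) (k : R.-pker S ~> S)
    (P : probability (infinite_path S) R) : Prop :=
  forall (w : nat -> S) (n : nat),
    P [set rho | forall i, (i <= n)%N -> rho i = w i] =
    mu [set w 0%N] * \prod_(i < n) k (w i) [set w i.+1].

Definition uniform01 (R : realType) : set (measurableTypeR R) -> \bar R :=
  mrestr (@lebesgue_measure R) (measurable_itv `[0%R, 1%R[).

HB.instance Definition _ (R : realType) := Measure.on (@uniform01 R).

Lemma uniform01T (R : realType) : @uniform01 R setT = 1.
Proof.
by rewrite /uniform01 /mrestr setTI lebesgue_measure_itv /= lte_fin ltr01 oppr0 adde0.
Qed.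

HB.instance Definition _ (R : realType) :=
  Measure_isProbability.Build _ _ _ (@uniform01 R) (@uniform01T R).

(* Existence of the law: a uniform variable u in [0, 1[ is sent to the path
   obtained by iterated inversion of distribution functions. The states are
   ordered by their code c, the interval of length nu {s} starting at
   nu {t | c t < c s} is assigned to s, and the position of u inside its
   interval is rescaled to [0, 1[ to sample the next state. *)
Section existence.
Context d (S : measurableType d) (R : realType) (k : R.-pker S ~> S).
Variable c : S -> nat.
Hypothesis c_inj : injective c.
Hypothesis discS : forall A : set S, measurable A.
Local Open Scope ring_scope.

Definition cumul (nu : set S -> \bar R) n : R :=
  fine (nu [set t | (c t < n)%N]).
Definition mass (nu : set S -> \bar R) s : R := fine (nu [set s]).

Section one_step.
Variable nu : {measure set S -> \bar R}.
Hypothesis nuT : nu setT = 1%E.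

Let nufin A : nu A \is a fin_num.
Proof.
rewrite ge0_fin_numE// (@le_lt_trans _ _ 1%E) ?ltry// -nuT.
by apply: le_measure; rewrite ?inE//; exact: discS.
Qed.

Lemma cumul0 : cumul nu 0 = 0.
Proof.
by rewrite /cumul (_ : [set _ | _] = set0) ?measure0// -subset0 => t.
Qed.

Lemma mass_ge0 s : 0 <= mass nu s.
Proof. by rewrite fine_ge0. Qed.

Lemma massE s : (mass nu s)%:E = nu [set s].
Proof. by rewrite fineK. Qed.

Lemma cumulS s : cumul nu (c s).+1 = cumul nu (c s) + mass nu s.
Proof.
rewrite /cumul /mass -fineD//; congr fine.
rewrite -measureU//; try exact: discS.
  congr (nu _); apply/seteqP; split=> t /=.
    by rewrite ltnS leq_eqVlt => /orP[/eqP/c_inj|]; [right|left].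
  by case=> [/ltnW//|->].
by rewrite -subset0 => t /= [] /[swap] ->; rewrite ltnn.
Qed.

Lemma cumulS0 n : (forall t, c t <> n) -> cumul nu n.+1 = cumul nu n.
Proof.
move=> cn; rewrite /cumul; congr (fine (nu _)); apply/seteqP; split=> t /=.
  by rewrite ltnS leq_eqVlt => /orP[/eqP/cn|].
by move/ltnW.
Qed.

Lemma cumul_le m n : (m <= n)%N -> cumul nu m <= cumul nu n.
Proof.
move=> mn; rewrite fine_le//; apply: le_measure; rewrite ?inE; try exact: discS.
by move=> t /= /leq_trans; exact.
Qed.

Lemma cumul_ge0 n : 0 <= cumul nu n. Proof. by rewrite fine_ge0. Qed.

Lemma cumul_le1 n : cumul nu n <= 1.
Proof.
rewrite -[leRHS]/(fine 1%E) -nuT fine_le//.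
by apply: le_measure; rewrite ?inE//; exact: discS.
Qed.

Lemma cumul_cvg (u : R) : u < 1 -> exists n, u < cumul nu n.
Proof.
move=> u1; apply: contrapT => /forallNP H.
pose F n := [set t | (c t < n)%N].
have FT : \bigcup_n F n = setT.
  by rewrite -subTset => t _; exists (c t).+1 => //; rewrite /F/=.
have ndF : nondecreasing_seq F.
  by move=> m n mn; apply/subsetPset => t /= /leq_trans; exact.
have := @nondecreasing_cvg_mu _ _ _ nu F (fun=> discS _) (discS _) ndF.
rewrite FT nuT => /cvg_lim => /(_ (@ereal_hausdorff _)) lim1.
have : (limn (nu \o F) <= u%:E)%E.
  apply: lime_le; first by apply: ereal_nondecreasing_is_cvgn => m n mn;
    apply: le_measure; rewrite ?inE; try exact: discS; exact/subsetPset/ndF.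
  apply: nearW => n /=; move: (H n) => /negP; rewrite -leNgt -lee_fin.
  by rewrite /cumul fineK.
by rewrite lim1 lee_fin leNgt u1.
Qed.

Definition pick_set (u : R) : set S :=
  [set s | cumul nu (c s) <= u < cumul nu (c s).+1].

Lemma pick_set_unique u s t : pick_set u s -> pick_set u t -> s = t.
Proof.
move=> /= /andP[s1 s2] /andP[t1 t2]; apply: c_inj.
have [st|ts|//] := ltngtP (c s) (c t).
- by have := cumul_le st; rewrite leNgt (le_lt_trans t1 s2).
- by have := cumul_le ts; rewrite leNgt (le_lt_trans s1 t2).
Qed.

Lemma pick_set_ex u : 0 <= u < 1 -> exists s, pick_set u s.
Proof.
move=> /andP[u0 u1].
have ex : exists n, u < cumul nu n by exact: cumul_cvg.
case: (ex_minnP ex) => -[|n]; first by rewrite cumul0 ltNge u0.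
move=> un nmin.
have un' : cumul nu n <= u.
  by rewrite leNgt; apply/negP => /nmin; rewrite ltnn.
have [[s cs]|/forallNP cn] := pselect (exists s, c s = n).
  by exists s; rewrite /pick_set/= cs un'.
by move: un; rewrite cumulS0// ltNge un'.
Qed.

End one_step.

Definition pick_state (nu : {measure set S -> \bar R}) u :=
  xget point (pick_set nu u).
Definition rescale (nu : {measure set S -> \bar R}) s u :=
  (u - cumul nu (c s)) / mass nu s.

Lemma pick_stateP (nu : {measure set S -> \bar R}) u s : nu setT = 1%E ->
  0 <= u < 1 -> (pick_state nu u = s) <-> pick_set nu u s.
Proof.
move=> nuT u01; have [t tu] := pick_set_ex nuT u01.
rewrite /pick_state; case: xgetP => [x _ xu|/(_ t)//].
by split=> [<-//|]; exact: pick_set_unique.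
Qed.

Fixpoint sample (nu : {measure set S -> \bar R}) (u : R) (n : nat) : S :=
  let s := pick_state nu u in
  if n is m.+1 then sample (k s) (rescale nu s u) m else s.

Lemma rescale01 (nu : {measure set S -> \bar R}) u s : nu setT = 1%E ->
  pick_set nu u s -> 0 <= rescale nu s u < 1.
Proof.
move=> nuT /=; rewrite /pick_set/= /rescale cumulS// => /andP[su us].
have m0 : 0 < mass nu s by lra.
apply/andP; split; first by rewrite divr_ge0 ?subr_ge0 // ltW.
by rewrite ltr_pdivrMr// mul1r; lra.
Qed.

Lemma pick_set01 (nu : {measure set S -> \bar R}) u s : nu setT = 1%E ->
  pick_set nu u s -> 0 <= u < 1.
Proof.
move=> nuT /= /andP[su us]; rewrite (le_trans _ su) ?cumul_ge0//=.
by rewrite (lt_le_trans us)// cumul_le1.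
Qed.

Lemma sample_cylinder n (nu : {measure set S -> \bar R}) (w : nat -> S) :
  nu setT = 1%E ->
  exists a b, [/\ 0 <= a, a <= b, b <= 1,
    [set u | 0 <= u < 1 /\ forall i, (i <= n)%N -> sample nu u i = w i] =
      [set` `[a, b[ ] &
    (b - a)%:E = (nu [set w 0%N] * \prod_(i < n) k (w i) [set w i.+1])%E].
Proof.
elim: n nu w => [|n IH] nu w nuT.
  exists (cumul nu (c (w 0%N))), (cumul nu (c (w 0%N)).+1); split.
  - exact: cumul_ge0.
  - by rewrite cumul_le.
  - exact: cumul_le1.
  - apply/seteqP; split=> u /=; rewrite in_itv/=.
      by move=> [u01 /(_ 0%N isT)/= /pick_stateP]; exact.
    move=> uw; have u01 : 0 <= u < 1 by exact: (@pick_set01 nu _ (w 0%N)).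
    by split=> // -[|//] _ /=; apply/pick_stateP.
  - by rewrite big_ord0 mule1 cumulS// addrAC subrr add0r massE.
have [a [b [a0 ab b1 abE abP]]] :=
  IH (k (w 0%N)) (w \o succn) (@prob_kernel _ _ _ _ _ k (w 0%N)).
set m := mass nu (w 0%N); set G := cumul nu (c (w 0%N)).
have m0 : 0 <= m by exact: mass_ge0.
have Gm : G + m = cumul nu (c (w 0%N)).+1 by rewrite cumulS.
have ? : 0 <= G by exact: cumul_ge0.
have ? : G + m <= 1 by rewrite Gm cumul_le1.
have ? : 0 <= m * a by exact: mulr_ge0.
have ? : m * a <= m * b by rewrite ler_wpM2l.
have ? : m * b <= m by rewrite ler_piMr.
exists (G + m * a), (G + m * b); split; [lra|lra|lra| |].
- apply/seteqP; split=> u /=.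
    move=> [u01 H].
    have uw : pick_set nu u (w 0%N) by apply/pick_stateP => //; exact: (H 0%N).
    have : [set u | 0 <= u < 1 /\ forall i : nat, (i <= n)%N ->
       sample (k (w 0%N)) u i = (w \o succn) i] (rescale nu (w 0%N) u).
      split=> [|i ni]; first exact: rescale01.
      by have := H i.+1 ni; rewrite /= (H 0%N isT : pick_state _ _ = _).
    rewrite abE /= !in_itv/= /rescale -/m -/G.
    have mgt0 : 0 < m by move: uw; rewrite /pick_set/= -Gm -/G => /andP[? ?]; lra.
    by rewrite ler_pdivlMr// ltr_pdivrMr// ![_ * m]mulrC => /andP[? ?];
      apply/andP; split; lra.
  rewrite in_itv/= => /andP[ua ub].
  have mgt0 : 0 < m by rewrite lt_neqAle m0 andbT eq_sym; apply/eqP => m00;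
    move: ua ub; rewrite m00; lra.
  have uw : pick_set nu u (w 0%N) by rewrite /pick_set/= -Gm -/G; apply/andP; split; lra.
  have u01 := pick_set01 nuT uw.
  have pu : pick_state nu u = w 0%N by apply/pick_stateP.
  split=> // -[//|i] ni.
  have : [set` `[a, b[] (rescale nu (w 0%N) u).
    rewrite /= in_itv/= /rescale -/m -/G ler_pdivlMr// ltr_pdivrMr// ![_ * m]mulrC.
    by apply/andP; split; lra.
  by rewrite -abE /= pu => -[_ /(_ i ni)].
- rewrite (_ : _ - _ = m * (b - a)); last by ring.
  by rewrite EFinM massE// abP big_ord_recl.
Qed.

Lemma sample_measurable n (nu : {measure set S -> \bar R}) (A : set S) :
  countable [set: S] -> nu setT = 1%E ->
  measurable [set u : R | 0 <= u < 1 /\ A (sample nu u n)].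
Proof.
move=> cS; elim: n nu => [|n IH] nu nuT.
  rewrite (_ : [set _ | _] = \bigcup_(s in A) [set u | pick_set nu u s]).
    rewrite bigcup_mkcond; apply: countable_bigcupT_measurable => // s.
    case: ifPn => // _.
    rewrite (_ : [set u | _] = [set` `[cumul nu (c s), cumul nu (c s).+1[ ])//.
  apply/seteqP; split=> u /=.
    by move=> [u01 Au]; exists (pick_state nu u) => //=; apply/pick_stateP.
  move=> [s As us]; have u01 := pick_set01 nuT us.
  by split=> //; have /pick_stateP -> := us.
rewrite (_ : [set _ | _] = \bigcup_s ([set` `[cumul nu (c s), cumul nu (c s).+1[ ]
   `&` rescale nu s @^-1` [set u | 0 <= u < 1 /\ A (sample (k s) u n)])).
  apply: countable_bigcupT_measurable => // s; apply: measurableI => //.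
  have mr : measurable_fun setT (rescale nu s).
    apply: measurable_funM => //; exact: measurable_funB.
  rewrite -[X in measurable X]setTI; apply: mr => //; apply: IH.
  exact: prob_kernel.
apply/seteqP; split=> u /=.
  move=> [u01 Au]; exists (pick_state nu u) => //=.
  have us : pick_set nu u (pick_state nu u) by apply/pick_stateP.
  by split; [rewrite in_itv|split=> //; exact: rescale01].
move=> [s _ [/=]]; rewrite in_itv/= => us [_ As]; have u01 := pick_set01 nuT us.
by split=> //; have /pick_stateP -> := us.
Qed.

End existence.

Lemma markov_law_exists d (S : measurableType d) (R : realType)
    (mu : probability S R) (k : R.-pker S ~> S) :
  countable_discrete S -> exists P, is_markov_law mu k P.
Proof.
move=> [cS discS]; have /countable_injP[c cinj] := cS.
have {}cinj : injective c by move=> x y; apply: cinj; rewrite inE.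
have muT := probability_setT mu.
pose phi (u : measurableTypeR R) : infinite_path S :=
  if (0 <= (u : R) < 1)%R then sample k c mu u else fun=> point.
have mphi : measurable_fun [set: measurableTypeR R] phi.
  apply: (@measurability _ _ (measurableTypeR R) (infinite_path S) _ _
    (@coordinate_sets _ S)) => //.
  move=> _ [_ [n _ [A _ <-]] <-]; rewrite !setTI.
  rewrite (_ : _ @^-1` _ =
    [set u : R | 0 <= u < 1 /\ A (sample k c mu u n)]%R `|`
    ((~` [set` `[0%R, 1%R[ ]) `&` [set u | A point])).
    apply: measurableU; first exact: sample_measurable.
    apply: measurableI; first by apply: measurableC.
    have [Ap|Ap] := pselect (A point).
      by rewrite (_ : [set _ | _] = setT) //; apply/seteqP; split=> x.
    by rewrite (_ : [set _ | _] = set0) //; apply/seteqP; split=> x.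
  apply/seteqP; split=> u /=; rewrite in_itv/= /phi; case: ifP => //.
  - by left.
  - by right.
  - by move=> _ [[]//|[]].
  - by move=> _ [[]//|[]].
exists (distribution (@uniform01 R) (mfun_Sub (mem_set mphi))) => w n.
have [a [b [a0 ab b1 abE <-]]] := sample_cylinder k cinj discS n w muT.
rewrite /distribution /= /pushforward /uniform01 /mrestr.
rewrite (_ : _ `&` _ = [set` `[a, b[ ]).
  rewrite lebesgue_measure_itv/= lte_fin.
  case: ifPn => //; rewrite -leNgt => ba.
  by rewrite (_ : b = a) ?subrr//; apply/eqP; rewrite eq_le ab ba.
rewrite -abE; apply/seteqP; split=> u /=; rewrite in_itv/= /phi.
  by move=> [] /[swap] u01; rewrite u01.
by move=> [u01]; rewrite u01.
Qed.

Lemma measurable_coordinate d (S : measurableType d) n :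
  measurable_fun [set: infinite_path S] (fun rho : infinite_path S => rho n).
Proof.
move=> _ A mA; rewrite setTI; apply: sub_sigma_algebra.
by exists n => //; exists A => //; rewrite setTI.
Qed.

Section uniqueness.
Context d (S : measurableType d) (R : realType).
Hypothesis discS : countable_discrete S.
Variables (mu : probability S R) (k : R.-pker S ~> S).
Variables P1 P2 : probability (infinite_path S) R.
Hypotheses (P1law : is_markov_law mu k P1) (P2law : is_markov_law mu k P2).

Let rect n j (w : nat -> S) (A : nat -> set S) : set (infinite_path S) :=
  [set rho | forall i, (i <= n)%N ->
     if (i < j)%N then rho i = w i else A i (rho i)].

Let measurable_rect n j w A : measurable (rect n j w A).
Proof.
rewrite (_ : rect _ _ _ _ = \bigcap_(i in [set i | (i <= n)%N])
   ((fun rho : infinite_path S => rho i) @^-1`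
     [set s | if (i < j)%N then s = w i else A i s])).
  apply: bigcap_measurableType => i _; rewrite -[X in measurable X]setTI.
  by apply: measurable_coordinate => //; exact: discS.2.
by apply/seteqP; split=> rho /= H i /H.
Qed.

Let rect_eq r n j w A : (j + r = n.+1)%N ->
  P1 (rect n j w A) = P2 (rect n j w A).
Proof.
have /countable_injP[c cinj] := discS.1.
have {}cinj : injective c by move=> x y; apply: cinj; rewrite inE.
elim: r j w => [|r IH] j w.
  rewrite addn0 => ->.
  rewrite (_ : rect _ _ _ _ =
      [set rho | forall i, (i <= n)%N -> rho i = w i]).
    by rewrite P1law P2law.
  by apply/seteqP; split=> rho /= H i ni; have := H i ni; rewrite ltnS ni.
move=> jr; pose F m := rect n j w A `&`
  (fun rho : infinite_path S => rho j) @^-1` [set s | c s = m].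
have jn : (j <= n)%N by rewrite -ltnS -jr addnS ltnS leq_addr.
have -> : rect n j w A = \bigcup_m F m.
  by apply/seteqP; split=> [rho H|rho [m _ []]//]; exists (c (rho j)).
have mF m : measurable (F m).
  apply: measurableI => //; rewrite -[X in measurable X]setTI.
  by apply: measurable_coordinate => //; exact: discS.2.
have tF : trivIset setT F.
  by move=> m1 m2 _ _ [rho [[_ /= <-] [_ /= <-]]].
have mUF : measurable (\bigcup_m F m) by exact: bigcupT_measurable.
rewrite (measure_semi_bigcup _ mF tF mUF) (measure_semi_bigcup _ mF tF mUF).
apply: eq_eseriesr => m _.
have [[s [sm As]]|Ns] := pselect (exists s, c s = m /\ A j s).
  rewrite (_ : F m = rect n j.+1 (fun i => if i == j then s else w i) A).
    by apply: IH; rewrite addSn -addnS.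
  apply/seteqP; split=> rho /=.
    move=> [H /= rm] i ni; have := H i ni; rewrite ltnS [(i <= j)%N]leq_eqVlt.
    have [->|_ //] := eqVneq i j.
    by move=> _ /=; apply: cinj; rewrite sm.
  move=> H; have rj : rho j = s by have := H j jn; rewrite ltnSn eqxx.
  split; last by rewrite /= rj.
  move=> i ni; have := H i ni; rewrite ltnS [(i <= j)%N]leq_eqVlt.
  by have [->|//] := eqVneq i j; rewrite ltnn rj.
rewrite (_ : F m = set0) ?measure0// -subset0 => rho [/(_ j jn)].
by rewrite ltnn => Aj /= cj; apply: Ns; exists (rho j).
Qed.

Lemma markov_law_unique E : measurable E -> P1 E = P2 E.
Proof.
move=> mE.
pose G := [set E | exists n A, E = rect n 0 (fun=> point) A].
apply: (measure_unique G (fun=> setT)) => //.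
- apply/seteqP; split; apply: smallest_sub.
  + exact: smallest_sigma_algebra.
  + move=> _ [n _ [A _ <-]]; apply: sub_sigma_algebra.
    exists n, (fun i => if i == n then A else setT).
    rewrite setTI; apply/seteqP; split=> rho /=.
      by move=> Ar i _; case: eqP => [->|].
    by move=> /(_ n (leqnn n)); rewrite eqxx.
  + exact: sigma_algebra_measurable.
  + by move=> _ [n [A ->]]; exact: measurable_rect.
- move=> _ _ [n1 [A1 ->]] [n2 [A2 ->]].
  exists (maxn n1 n2), (fun i =>
    [set s | ((i <= n1)%N -> A1 i s) /\ ((i <= n2)%N -> A2 i s)]).
  apply/seteqP; split=> rho /=.
    by move=> [H1 H2] i _; split=> [/H1|/H2].
  move=> H; split=> i ni; have := H i; rewrite leq_max ni ?orbT => /(_ isT) [].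
    by move=> /(_ isT).
  by move=> _ /(_ isT).
- move=> _; exists 0%N, (fun=> setT); apply/seteqP; split=> //.
- by rewrite bigcup_const//; exists 0%N.
- by move=> _ [n [A ->]]; exact: (@rect_eq n.+1).
- by move=> _; rewrite -[ltLHS]/(P1 setT) probability_setT ltry.
Qed.

End uniqueness.

Record markov_chain (R : realType) := MarkovChain {
  mc_disp : measure_display;
  mc_state :> measurableType mc_disp;
  mc_countable_discrete : countable_discrete mc_state;
  mc_kernel : R.-pker mc_state ~> mc_state;
  mc_AP : finType;
  mc_label : mc_state -> {set mc_AP} }.

Arguments mc_kernel {R} m.
Arguments mc_countable_discrete {R} m.

Section markov_chain_notions.
Context (R : realType) (T : markov_chain R).

Definition Prob (mu : probability T R) : probability (infinite_path T) R :=
  sval (cid (markov_law_exists mu (mc_kernel T) (mc_countable_discrete T))).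

Lemma Prob_markov_law mu : is_markov_law mu (mc_kernel T) (Prob mu).
Proof. exact: svalP. Qed.

(* The event F B. *)
Definition visits (B : set T) : set (infinite_path T) :=
  [set rho | exists i, B (rho i)].

Definition attractor (B : set T) : Prop :=
  forall mu : probability T R, Prob mu (visits B) = 1.

Definition transition (x y : T) : bool := 0 < mc_kernel T x [set y].

(* The sequence of transitions may be empty. *)
Definition reaches (x y : T) : Prop :=
  exists p : seq T, path transition x p /\ last x p = y.

End markov_chain_notions.

(* The directed graph with vertex set [B] and edge relation [edge], the latter
   restricted to [B]; strongly connected components are the classes of mutual
   reachability in this graph. *)
Section digraph.
Context (V : Type) (B : set V) (edge : V -> V -> Prop).

Definition walk (x y : V) : Prop :=
  clos_refl_trans V (fun u v => [/\ B u, B v & edge u v]) x y.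

Definition is_scc (C : set V) : Prop :=
  exists2 x, B x & C = [set y | [/\ B y, walk x y & walk y x]].

Definition is_bscc (C : set V) : Prop :=
  is_scc C /\ forall x y, C x -> B y -> edge x y -> C y.

End digraph.

Record dma (AP : finType) := DMA {
  dma_state : finType;
  dma_init : dma_state;
  dma_edge : {set dma_state * {set AP} * dma_state};
  dma_deterministic : forall q u, exists! q', (q, u, q') \in dma_edge;
  dma_accept : {set {set dma_state}} }.

(* An alias of [dma_state M] that carries the discrete sigma-algebra. *)
Definition dma_space (AP : finType) (M : dma AP) : Type := dma_state M.

Section dma_space.
Context (AP : finType) (M : dma AP).
HB.instance Definition _ := Finite.on (dma_space M).
HB.instance Definition _ := isPointed.Build (dma_space M) (dma_init M).
HB.instance Definition _ := @isMeasurable.Build default_measure_display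
  (dma_space M) discrete_measurable discrete_measurable0
  discrete_measurableC discrete_measurableU.
End dma_space.

Section product.
Context (R : realType) (T : markov_chain R) (M : dma (mc_AP T)).

Definition dma_step (q : dma_space M) (u : {set mc_AP T}) : dma_space M :=
  sval (cid (dma_deterministic q u)).

Lemma dma_stepE q u q' : ((q, u, q') \in dma_edge M) = (dma_step q u == q').
Proof.
rewrite /dma_step; case: cid => q1 /= [q1E q1u].
by apply/idP/eqP => [/q1u//|<-].
Qed.

Lemma product_countable_discrete : countable_discrete (T * dma_space M)%type.
Proof.
have [Tc Td] := mc_countable_discrete T.
have c : countable [set: T * dma_space M].
  by rewrite -setXTT; apply: countableX.
split=> // A; apply: countable_measurable; last first.
  by apply: sub_countable c; exact: subset_card_le.
move=> [s q]; rewrite (_ : [set (s, q)] = [set s] `*` [set q]); last first.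
  by apply/seteqP; split=> [_ ->//|[s1 q1] [/= -> ->]].
by apply: measurableX; [exact: Td|].
Qed.

Let step (x : T * dma_space M) (s : T) : T * dma_space M :=
  (s, dma_step x.2 (mc_label x.1)).

Let mstep x : measurable_fun setT (step x).
Proof. by move=> _ A _; case: (mc_countable_discrete T) => _; exact. Qed.

Definition step_measure (x : T * dma_space M) :
    set (T * dma_space M) -> \bar R :=
  pushforward (mc_kernel T x.1) (step x).

Let step_measure0 x : step_measure x set0 = 0.
Proof. by rewrite /step_measure /pushforward preimage_set0 measure0. Qed.

Let step_measure_ge0 x A : 0 <= step_measure x A.
Proof. exact: measure_ge0. Qed.

Let step_measure_sigma_additive x : semi_sigma_additive (step_measure x).
Proof. by apply: measure_semi_sigma_additive; exact: mstep. Qed.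

HB.instance Definition _ x := isMeasure.Build _ _ _ (step_measure x)
  (step_measure0 x) (step_measure_ge0 x) (@step_measure_sigma_additive x).

Definition product_kernel (x : T * dma_space M) :
  {measure set (T * dma_space M) -> \bar R} := step_measure x.

Let measurable_product_kernel U : measurable U ->
  measurable_fun [set: T * dma_space M] (product_kernel ^~ U).
Proof. by move=> _ _ A _; case: product_countable_discrete => _; exact. Qed.

HB.instance Definition _ := isKernel.Build _ _ _ _ R product_kernel
  measurable_product_kernel.

Let product_kernelT x : product_kernel x setT = 1.
Proof.
by rewrite /product_kernel/= /step_measure/pushforward preimage_setT prob_kernel.
Qed.

HB.instance Definition _ := Kernel_isProbability.Build _ _ _ _ R
  product_kernel product_kernelT.

(* The step distribution is the image of that of T under s' |-> (s', q'), where
   q' is the successor of q on the label of s. *)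
Lemma product_kernelE s q s' q' :
  product_kernel (s, q) [set (s', q')] =
  if (q, mc_label s, q') \in dma_edge M then mc_kernel T s [set s'] else 0.
Proof.
rewrite dma_stepE /product_kernel/= /step_measure /pushforward /=; case: eqP => [<-|qq'].
  by congr (mc_kernel T _ _); apply/seteqP; split=> [s1 [] //|_ ->].
by rewrite [X in mc_kernel T _ X](_ : _ = set0) ?measure0// -subset0 => s1 [].
Qed.

(* The labelling by q is read as labelling by the singleton {q} over the
   propositions Q. *)
Definition product_chain : markov_chain R :=
  @MarkovChain R _ _ product_countable_discrete product_kernel (dma_state M)
    (fun x => [set (x.2 : dma_state M)]%SET).

Definition product_init (mu : probability T R) : probability product_chain R :=
  mu \x \d_(dma_init M : dma_space M).

(* Second components occurring infinitely often along rho. *)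
Definition inf_states (rho : infinite_path product_chain) : {set dma_state M} :=
  [set q : dma_state M | `[< forall n, exists2 m, (n <= m)%N & (rho m).2 = q :> dma_state M >]]%SET.

Definition inf_in (F : {set {set dma_state M}}) : set (infinite_path product_chain) :=
  [set rho | inf_states rho \in F].

(* The edges of the graph on B are given by reachability in the product. *)
Definition good (F : {set {set dma_state M}}) (B : set product_chain) :
    set (set product_chain) :=
  [set C | is_bscc B (@reaches R product_chain) C /\
    exists2 F0, F0 \in F &
      (forall x y : product_chain, C x -> reaches x y -> y.2 \in F0) /\
      (forall q : dma_state M, q \in F0 ->
        exists (s : T) (x : product_chain), C x /\ reaches x (s, q))].

End product.

Arguments product_chain {R} T M.
Arguments good {R T M} F B.
Arguments inf_in {R T M} F.
Arguments product_init {R T M} mu.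

(* Main.v *)
(** Almost surely, the path takes only transitions of positive probability, meets
B infinitely often, and meets y infinitely often whenever it meets x infinitely
often and x -> y is a transition. On such a path the states of B that occur
infinitely often form a BSCC of the graph, every BSCC that is visited equals
this one, and the automaton states occurring infinitely often are exactly those
reachable from it. Up to a null set, Inf \in F is therefore the disjoint union of
the events F C for C good. *)
Require Import Defs.
From HB Require Import structures.
From mathcomp Require Import all_boot all_order all_algebra.
From mathcomp Require Import all_classical all_reals all_analysis.
From mathcomp Require Import measurable_realfun.

Set Implicit Arguments.
Unset Strict Implicit.
Unset Printing Implicit Defensive.
Import Order.TTheory GRing.Theory Num.Theory.

Local Open Scope classical_set_scope.
Local Open Scope ereal_scope.

(** * Comparing probabilities of events up to null sets *)

Section ae_prob.
Context d (T : measurableType d) (R : realType) (P : probability T R).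
Variables (A B : set T).
Hypotheses (mA : measurable A) (mB : measurable B).

(** A probability is the integral of an indicator function, and integrals ignore null sets. *)
Lemma ae_eq_prob : {ae P, forall x, A x <-> B x} -> P A = P B.
Proof.
move=> AB; rewrite -(setIT A) -(setIT B) -!integral_indic//.
apply: ae_eq_integral => //.
- exact/measurable_EFinP/measurable_indic.
- exact/measurable_EFinP/measurable_indic.
- by apply: filterS AB => x ABx _; rewrite !indicE; congr ((nat_of_bool _)%:R%:E);
    apply/idP/idP; rewrite !inE => /ABx.
Qed.

End ae_prob.

Lemma ae_le_prob d (T : measurableType d) (R : realType) (P : probability T R)
    (A B : set T) : measurable A -> measurable B ->
  {ae P, forall x, A x -> B x} -> P A <= P B.
Proof.
move=> mA mB AB; rewrite (@ae_eq_prob _ _ _ _ A (A `&` B))//.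
- by apply: le_measure; rewrite ?inE//; exact: measurableI.
- exact: measurableI.
- by apply: filterS AB => x ABx; split=> [Ax|[]//]; split=> //; exact: ABx.
Qed.

Lemma prob1_ae d (T : measurableType d) (R : realType) (P : probability T R)
    (A : set T) : measurable A -> P A = 1 -> {ae P, forall x, A x}.
Proof.
move=> mA PA; apply/negligibleP; first exact: measurableC.
by have := probability_setC P mA; rewrite PA subee.
Qed.

Lemma prob0_ae d (T : measurableType d) (R : realType) (P : probability T R)
    (A : set T) : measurable A -> P A = 0 -> {ae P, forall x, (~` A) x}.
Proof.
by move=> mA PA; exists A; split=> // x /= /contrapT.
Qed.

Lemma sub_ae d (T : measurableType d) (R : realType) (P : probability T R)
    (A B : set T) : {ae P, forall x, A x} -> (forall x, A x -> B x) ->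
  {ae P, forall x, B x}.
Proof. by move=> aeA AB; apply: filterS aeA. Qed.

(** * Measurable events on the path space and the shift *)

Section path_space.
Context (R : realType) (X : markov_chain R).
Implicit Types (mu : probability X R) (E : set (infinite_path X)).

Definition shift (rho : infinite_path X) : infinite_path X := fun i => rho i.+1.

Lemma measurable_state (A : set X) : measurable A.
Proof. by case: (mc_countable_discrete X). Qed.

Lemma measurable_at n (A : set X) :
  measurable [set rho : infinite_path X | A (rho n)].
Proof.
rewrite -[X in measurable X]setTI.
by apply: (@measurable_coordinate _ X n) => //; exact: measurable_state.
Qed.

Lemma measurable_forallnat (F : nat -> set (infinite_path X)) :
  (forall n, measurable (F n)) -> measurable [set rho | forall n, F n rho].
Proof.
move=> mF; rewrite (_ : [set _ | _] = \bigcap_n F n).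
  exact: bigcapT_measurable.
by apply/seteqP; split=> rho /= H n; [move=> _|]; exact: H.
Qed.

Lemma measurable_existsnat (F : nat -> set (infinite_path X)) :
  (forall n, measurable (F n)) -> measurable [set rho | exists n, F n rho].
Proof.
move=> mF; rewrite (_ : [set _ | _] = \bigcup_n F n).
  exact: bigcupT_measurable.
by apply/seteqP; split=> rho /= [n]; exists n.
Qed.

Lemma measurable_visits (A : set X) : measurable (visits A).
Proof. by apply: measurable_existsnat => n; exact: measurable_at. Qed.

Definition infinitely_often (A : set X) : set (infinite_path X) :=
  [set rho | forall n, exists m, (n <= m)%N /\ A (rho m)].

Lemma measurable_infinitely_often A : measurable (infinitely_often A).
Proof.
apply: measurable_forallnat => n; apply: measurable_existsnat => m.
(* The index condition is moved into the set of states, so that only coordinate [m] is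
   constrained. *)
exact: (@measurable_at m [set s | (n <= m)%N /\ A s]).
Qed.

Lemma measurable_cylinder (w : nat -> X) n :
  measurable [set rho : infinite_path X | forall i, (i <= n)%N -> rho i = w i].
Proof.
apply: measurable_forallnat => i.
exact: (@measurable_at i [set s | (i <= n)%N -> s = w i]).
Qed.

Lemma measurable_shift : measurable_fun setT shift.
Proof.
apply: (@measurability _ _ (infinite_path X) (infinite_path X) _ _
  (@coordinate_sets _ X)) => //.
move=> _ [_ [n _ [A _ <-]] <-]; rewrite !setTI.
exact: (@measurable_at n.+1 A).
Qed.

Lemma measurable_shiftV E : measurable E -> measurable (shift @^-1` E).
Proof. by move=> mE; rewrite -[X in measurable X]setTI; exact: measurable_shift. Qed.

Lemma measurable_fun_state d (Y : sigmaRingType d) (f : X -> Y) (D : set X) :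
  measurable_fun D f.
Proof. by move=> _ B _; exact: measurable_state. Qed.

(** * Mixtures over the starting state, the Markov property and its almost sure consequences *)

Definition next_law (s : X) : set X -> \bar R := mc_kernel X s.
HB.instance Definition _ s := Measure.on (next_law s).
HB.instance Definition _ s :=
  Measure_isProbability.Build _ _ _ (next_law s) (prob_kernel s).

Definition Prob_from (s : X) : probability (infinite_path X) R :=
  Prob (@dirac _ X s R).

Definition mixture mu (E : set (infinite_path X)) : \bar R :=
  \int[mu]_s Prob_from s E.

Section mixture.
Variable mu : probability X R.

Let mixture0 : mixture mu set0 = 0.
Proof. by apply: integral0_eq => s _; rewrite measure0. Qed.

Let mixture_ge0 E : 0 <= mixture mu E.
Proof. by apply: integral_ge0 => s _; exact: measure_ge0. Qed.

Let mixture_sigma_additive : semi_sigma_additive (mixture mu).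
Proof.
move=> U mU tU mUU; rewrite [X in _ --> X](_ : _ =
  \int[mu]_s (\sum_(n <oo) Prob_from s (U n))); last first.
  apply: eq_integral => s _.
  by apply/esym/cvg_lim => //; exact/measure_semi_sigma_additive.
(* The limit exists because the terms are nonnegative; its value comes from exchanging sum and
   integral. *)
apply/cvg_closeP; split.
  by apply: is_cvg_nneseries => n _ _; exact: integral_ge0.
rewrite closeE// integral_nneseries// => n.
exact: measurable_fun_state.
Qed.

HB.instance Definition _ := isMeasure.Build _ _ R (mixture mu)
  mixture0 mixture_ge0 mixture_sigma_additive.

Let mixtureT : mixture mu setT = 1.
Proof.
rewrite /mixture (eq_integral (cst 1)); last by move=> s _; exact: probability_setT.
by rewrite integral_cst// mul1e; exact: (@probability_setT _ _ _ mu).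
Qed.

HB.instance Definition _ :=
  Measure_isProbability.Build _ _ _ (mixture mu) mixtureT.

End mixture.

Lemma prod_kernel_ge0 n (w : nat -> X) :
  0 <= \prod_(i < n) mc_kernel X (w i) [set w i.+1].
Proof. by apply: prode_ge0. Qed.

(* The mixture of the laws started at fixed states satisfies the cylinder
   equations, and these determine the law. *)
Lemma Prob_mixture mu E : measurable E ->
  Prob mu E = \int[mu]_s Prob_from s E.
Proof.
move=> mE; rewrite -/(mixture mu E).
apply: (markov_law_unique (mc_countable_discrete X) (Prob_markov_law mu)) => //.
move=> w n; rewrite /= /mixture.
under eq_integral do rewrite Prob_markov_law.
rewrite ge0_integralZr//; last 2 first.
  - exact: measurable_fun_state.
  - exact: prod_kernel_ge0.
(* What is left to integrate, the Dirac mass of [[set w 0]] at [s], is an indicator function of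
   [s]. *)
congr (_ * _); rewrite -[X in _ = _ X]setIT.
rewrite -integral_indic//; last exact: measurable_state.
Qed.

Lemma ae_Prob_from_start s : {ae Prob_from s, forall rho, rho 0%N = s}.
Proof.
have m0 : measurable [set rho : infinite_path X | rho 0%N = s].
  exact: (@measurable_at 0%N [set s]).
apply: (prob1_ae m0); rewrite (_ : [set rho | _] =
  [set rho | forall i, (i <= 0)%N -> rho i = s]).
  by rewrite (Prob_markov_law _ (fun=> s)) big_ord0 mule1 /= diracE mem_set.
by apply/seteqP; split=> [rho /= r0 [|//]|rho /= /(_ 0%N)]; [|exact].
Qed.

(** Markov property at time 1. The law of the shifted path satisfies the cylinder equations for
    [next_law s]: putting [s] in front of a cylinder adds exactly the factor for the first step. *)
Lemma Prob_from_shift s E : measurable E ->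
  Prob_from s (shift @^-1` E) = Prob (next_law s) E.
Proof.
pose P := distribution (Prob_from s) (mfun_Sub (mem_set measurable_shift)).
suff Plaw : is_markov_law (next_law s) (mc_kernel X) P.
  by move=> mE; exact: (markov_law_unique (mc_countable_discrete X) Plaw
    (Prob_markov_law _)).
move=> w n.
rewrite -[LHS]/(Prob_from s (shift @^-1` [set rho : infinite_path X |
  forall i, (i <= n)%N -> rho i = w i])).
pose w' i := if i is j.+1 then w j else s.
have mcyl := measurable_cylinder.
rewrite (@ae_eq_prob _ _ _ (Prob_from s) (_ @^-1` _)
    [set rho : infinite_path X | forall i, (i <= n.+1)%N -> rho i = w' i]).
- rewrite [LHS](Prob_markov_law (@dirac _ X s R) w' n.+1).
  rewrite /= diracE mem_set// mul1e big_ord_recl /=.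
  by congr (_ * _).
- by apply: measurable_shiftV; exact: mcyl.
- exact: mcyl.
- apply: (sub_ae (ae_Prob_from_start s)) => rho r0; split=> /= H.
    by case=> [//|i] /H.
  by move=> i ni; exact: (H i.+1).
Qed.

(** Induction on [n]: by the Markov property, the suffix from [n.+1] on has the law of the suffix
    from [n] on under some [next_law s], averaged over [s]. Hence the quantification over all
    initial distributions. *)
Lemma ae_suffix (Q : set (infinite_path X)) : measurable Q ->
  (forall mu, {ae Prob mu, forall rho, Q rho}) ->
  forall n mu, {ae Prob mu, forall rho, Q (fun i => rho (n + i)%N)}.
Proof.
move=> mQ aeQ; elim=> [|n IH] mu; first exact: aeQ.
have mS : measurable [set rho : infinite_path X | Q (fun i => rho (n + i)%N)].
  elim: n {IH} => [//|n IH]; first exact: (measurable_shiftV IH).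
have mSC : measurable (~` [set rho : infinite_path X |
    Q (fun i => rho (n.+1 + i)%N)]).
  by apply: measurableC; exact: (measurable_shiftV mS).
apply/negligibleP; first exact: mSC.
rewrite [LHS](Prob_mixture _ mSC).
apply: integral0_eq => s _.
(* [n.+1 + i] computes to [(n + i).+1], so the event is a shift preimage by conversion. *)
rewrite -[X in Prob_from s X]/(shift @^-1`
  (~` [set rho : infinite_path X | Q (fun i => rho (n + i)%N)])).
rewrite Prob_from_shift; last exact: measurableC.
by apply/negligibleP; [exact: measurableC|exact: IH].
Qed.

(** Countability of the state space: states are replaced by their codes, and countably many null
    sets have a null union. *)
Lemma ae_forall_state (P : probability (infinite_path X) R)
    (Q : X -> set (infinite_path X)) :
  (forall s, {ae P, forall rho, Q s rho}) ->
  {ae P, forall rho, forall s, Q s rho}.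
Proof.
have /countable_injP[c cinj] := (mc_countable_discrete X).1.
have {}cinj : injective c by move=> x y; apply: cinj; rewrite inE.
move=> aeQ; have : {ae P, forall rho, forall n s, c s = n -> Q s rho}.
  apply: ae_foralln => n.
  have [[s sn]|ns] := pselect (exists s, c s = n).
    by apply: (sub_ae (aeQ s)) => rho Qs t; rewrite -sn => /cinj ->.
  by apply: aeW => rho s sn; case: ns; exists s.
by move/sub_ae; apply => rho H s; exact: (H (c s)).
Qed.

Lemma ae_transition mu :
  {ae Prob mu, forall rho, forall n, transition (rho n) (rho n.+1)}.
Proof.
apply: ae_foralln => n.
suff : {ae Prob mu, forall rho, forall s t,
    ~~ transition s t -> ~ (rho n = s /\ rho n.+1 = t)}.
  move/sub_ae; apply => rho H; apply: contrapT => /negP Nt.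
  by apply: (H _ _ Nt).
apply: ae_forall_state => s; apply: ae_forall_state => t.
have [st|st] := boolP (transition s t); first exact: aeW.
(* A forbidden step at time 0 is a cylinder whose probability has a zero factor; [ae_suffix] carries
   this to time [n]. *)
pose w i := if i is 0%N then s else t.
pose Q := ~` [set rho : infinite_path X | forall i, (i <= 1)%N -> rho i = w i].
have mQ : measurable Q by apply: measurableC; exact: measurable_cylinder.
have aeQ nu : {ae Prob nu, forall rho, Q rho}.
  apply: prob0_ae; first exact: measurable_cylinder.
  rewrite [LHS]Prob_markov_law big_ord1/=.
  have -> : mc_kernel X s [set t] = 0.
    by apply/eqP; rewrite -measure_le0 leNgt.
  by rewrite mule0.
apply: (sub_ae (ae_suffix mQ aeQ n mu)) => rho Qrho _ [rn rn1].
apply: Qrho => -[|[|//]] _ /=; first by rewrite addn0.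
by rewrite addn1.
Qed.

(** Every suffix visits the attractor almost surely, since it does so from any initial
    distribution. *)
Lemma ae_infinitely_often_attractor (B : set X) mu : attractor B ->
  {ae Prob mu, forall rho, infinitely_often B rho}.
Proof.
move=> attB.
have aeB nu : {ae Prob nu, forall rho, visits B rho}.
  by apply: prob1_ae (attB nu); exact: measurable_visits.
apply: ae_foralln => n.
apply: (sub_ae (ae_suffix (measurable_visits B) aeB n mu)) => rho [i Bi].
by exists (n + i)%N; rewrite leq_addr.
Qed.

(** * Recurrence passes along transitions of positive probability *)

Section transition_recurrence.
Variables x y : X.
Hypothesis xy : transition x y.

(* A path in [avoid] passes through x, so its probability is at most g (the
   probability when started at x) from any starting state; leaving x without
   entering y then gives g <= g * (1 - kappa(x, y)), hence g = 0. *)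
Let avoid : set (infinite_path X) :=
  infinitely_often [set x] `&` ~` visits [set y].

Let mavoid : measurable avoid.
Proof.
apply: measurableI; first exact: measurable_infinitely_often.
by apply: measurableC; exact: measurable_visits.
Qed.

Let avoid_shift rho : avoid rho -> avoid (shift rho).
Proof.
move=> [io Ny]; split=> [n|[i yi]]; last by apply: Ny; exists i.+1.
by have [[|m] [nm xm]] := io n.+1; [|exists m].
Qed.

Let hits N : set (infinite_path X) :=
  [set rho | exists i, (i <= N)%N /\ rho i = x].

Let mhits N : measurable (hits N).
Proof.
apply: measurable_existsnat => i.
exact: (@measurable_at i [set s | (i <= N)%N /\ s = x]).
Qed.

Let g := Prob_from x avoid.

(** Induction on the time allowed to reach [x]. From [s] other than [x], one step leaves a path
    still in [avoid] with one unit of time less, so an average of values at most [g] bounds the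
    probability. *)
Let avoid_hits N s : Prob_from s (avoid `&` hits N) <= g.
Proof.
elim: N s => [|N IH] s.
  have [->|sx] := pselect (s = x).
    by apply: le_measure; rewrite ?inE//; exact: measurableI.
  apply: (@le_trans _ _ (Prob_from s set0)); last first.
    by rewrite measure0; exact: measure_ge0.
  apply: (@ae_le_prob _ _ _ (Prob_from s)) => //; first exact: measurableI.
  apply: (sub_ae (ae_Prob_from_start s)) => rho rs [_ [i []]].
  by rewrite leqn0 => /eqP ->; rewrite rs.
have [->|sx] := pselect (s = x).
  by apply: le_measure; rewrite ?inE//; exact: measurableI.
have mah : measurable (avoid `&` hits N) by exact: measurableI.
apply: (@le_trans _ _ (Prob_from s (shift @^-1` (avoid `&` hits N)))).
  apply: (@ae_le_prob _ _ _ (Prob_from s)).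
  - exact: measurableI.
  - exact: measurable_shiftV.
  apply: (sub_ae (ae_Prob_from_start s)) => rho rs [av [[|i] [iN rx]]].
    by rewrite rs in rx.
  by split; [exact: avoid_shift|exists i].
rewrite Prob_from_shift// Prob_mixture//.
rewrite -[leRHS]mule1 -(@probability_setT _ _ _ (next_law s)) -integral_cst//.
apply: ge0_le_integral => //; exact: measurable_fun_state.
Qed.

(** Every path in [avoid] hits [x] at some time, so the events of [avoid_hits] increase to [avoid];
    continuity from below gives the bound. *)
Let avoid_from s : Prob_from s avoid <= g.
Proof.
have aU : \bigcup_N (avoid `&` hits N) = avoid.
  apply/seteqP; split=> [rho [N _ []]//|rho arho].
  have [m [_ rm]] := arho.1 0%N.
  by exists m => //; split=> //; exists m.
have nd : nondecreasing_seq (fun N => avoid `&` hits N).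
  move=> m n mn; apply/subsetPset => rho [arho [i [im ri]]].
  by split=> //; exists i; rewrite (leq_trans im).
have := @nondecreasing_cvg_mu _ _ _ (Prob_from s) _
  (fun N => measurableI _ _ mavoid (mhits N)) _ nd.
rewrite aU => /(_ mavoid) /cvg_lim => /(_ (@ereal_hausdorff _)) <-.
apply: lime_le; last by apply: nearW => N; exact: avoid_hits.
by apply: ereal_nondecreasing_is_cvgn => m n mn; apply: le_measure;
  rewrite ?inE; try exact: measurableI; exact/subsetPset/nd.
Qed.

Let avoid0 : g = 0.
Proof.
have gy : Prob_from y avoid = 0.
  apply/eqP; rewrite -measure_le0 -(@measure0 _ _ _ (Prob_from y)).
  apply: (@ae_le_prob _ _ _ (Prob_from y)) => //.
  by apply: (sub_ae (ae_Prob_from_start y)) => rho ry [_]; apply; exists 0%N.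
have gle : g <= g * next_law x (~` [set y]).
  apply: (@le_trans _ _ (Prob_from x (shift @^-1` avoid))).
    by apply: le_measure; rewrite ?inE//; exact: measurable_shiftV.
  rewrite Prob_from_shift// Prob_mixture//.
  rewrite -integral_cst; last exact: measurable_state.
  (* The integrand over the next state is at most [g] off [y], and is 0 at [y] by [gy]. *)
  rewrite [leRHS]integral_mkcond.
  apply: ge0_le_integral => //; try exact: measurable_fun_state.
  move=> s _; rewrite patchE; case: ifPn => [_|]; first exact: avoid_from.
  by rewrite notin_setE /= => /contrapT ->; rewrite gy.
have p0 : 0 < next_law x [set y] by exact: xy.
have gfin : g \is a fin_num by exact: fin_num_measure.
have pfin : next_law x [set y] \is a fin_num.
  by apply: (@fin_num_measure _ _ _ (next_law x)); exact: measurable_state.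
have g0 : 0 <= g by exact: measure_ge0.
move: gle.
have -> : next_law x (~` [set y]) = 1 - next_law x [set y].
  by apply: (@probability_setC _ _ _ (next_law x)); exact: measurable_state.
move: p0 g0; rewrite -(fineK gfin) -(fineK pfin) -EFinB -EFinM !lee_fin lte_fin.
(* In real numbers, [g <= g * (1 - p)] amounts to [g * p <= 0], and [p] is positive. *)
move=> p0 g0; rewrite mulrBr mulr1 lerBrDr gerDl => gp; congr EFin.
by apply/eqP; rewrite eq_le g0 andbT -(pmulr_lle0 _ p0).
Qed.

(** If [x] recurred while [y] stopped occurring, some suffix would lie in [avoid], which is null
    from every initial distribution. *)
Lemma ae_infinitely_often_transition mu :
  {ae Prob mu, forall rho,
    infinitely_often [set x] rho -> infinitely_often [set y] rho}.
Proof.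
have ae_avoid nu : {ae Prob nu, forall rho, (~` avoid) rho}.
  apply: prob0_ae => //; rewrite [LHS]Prob_mixture//; apply: integral0_eq => s _.
  by apply/eqP; rewrite -measure_le0 -avoid0 avoid_from.
suff : {ae Prob mu, forall rho, forall n,
    (~` avoid) (fun i => rho (n + i)%N)}.
  move/sub_ae; apply => rho H io n; apply: contrapT => Ny.
  apply: (H n); split=> [m|[i yi]].
    have [l [nl xl]] := io (n + m)%N.
    exists (l - n)%N; rewrite leq_subRL ?(leq_trans (leq_addr _ _) nl)//.
    by rewrite subnKC// (leq_trans (leq_addr _ _) nl).
  by apply: Ny; exists (n + i)%N; rewrite leq_addr.
apply: ae_foralln => n.
by apply: (ae_suffix _ ae_avoid); exact: measurableC.
Qed.

End transition_recurrence.

End path_space.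

(** * Reachability, components of the graph and typical paths *)

Section typical_paths.
Context (R : realType) (X : markov_chain R).
Implicit Types (B C : set X) (rho : infinite_path X).

Lemma reaches_refl (x : X) : reaches x x.
Proof. by exists [::]. Qed.

Lemma reaches_trans (x y z : X) : reaches x y -> reaches y z -> reaches x z.
Proof.
move=> [p [xp <-]] [q [yq <-]]; exists (p ++ q).
by rewrite cat_path xp last_cat.
Qed.

Lemma reaches_transition (x y : X) : transition x y -> reaches x y.
Proof. by move=> xy; exists [:: y]; rewrite /= xy. Qed.

(** The edge relation is itself reflexive and transitive, so walks add nothing to it; with
    [reaches_walk], both relations agree on [B]. *)
Lemma walk_reaches B (x y : X) : walk B (@reaches R X) x y -> reaches x y.
Proof.
elim=> [u v []//|u|u v w _ uv _ vw]; first exact: reaches_refl.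
exact: reaches_trans uv vw.
Qed.

Lemma reaches_walk B (x y : X) :
  B x -> B y -> reaches x y -> walk B (@reaches R X) x y.
Proof. by move=> Bx By xy; apply: Relation_Operators.rt_step. Qed.

(** Mutual reachability is an equivalence, so any member can serve as representative; two components
    sharing a state therefore coincide. *)
Lemma is_sccE B C (x : X) : is_scc B (@reaches R X) C -> C x ->
  C = [set y | [/\ B y, reaches x y & reaches y x]].
Proof.
move=> [z Bz ->] [Bx /walk_reaches zx /walk_reaches xz].
apply/seteqP; split=> y.
  move=> [By /walk_reaches zy /walk_reaches yz]; split=> //.
    exact: reaches_trans xz zy.
  exact: reaches_trans yz zx.
move=> [By xy yx]; split=> //; apply: reaches_walk => //.
  exact: reaches_trans zx xy.
exact: reaches_trans yx xz.
Qed.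

(** Pigeonhole, by induction on a list of the elements: if [x] no longer occurs from time [n] on,
    later visits fall in the rest of the list. *)
Lemma infinitely_often_finite B rho : finite_set B ->
  infinitely_often B rho -> exists2 x, B x & infinitely_often [set x] rho.
Proof.
move=> /finite_seqP[s ->]; elim: s => [|x s IH] io.
  by have [m [_]] := io 0%N.
have [iox|/existsNP[n Nx]] := pselect (infinitely_often [set x] rho).
  by exists x => //; rewrite /= mem_head.
have [|y ys ioy] := IH.
  move=> m; have [l [ml]] := io (maxn n m).
  move: ml; rewrite geq_max => /andP[nl ml]; rewrite /= inE => /orP[/eqP lx|ls].
    by case: Nx; exists l.
  by exists l.
by exists y => //; rewrite /= inE ys orbT.
Qed.

(** These properties isolate the probabilistic input; acceptance is then analysed on one path at a
    time. *)
Definition typical B rho : Prop :=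
  [/\ forall n, transition (rho n) (rho n.+1), infinitely_often B rho &
    forall x y, transition x y ->
      infinitely_often [set x] rho -> infinitely_often [set y] rho].

Lemma ae_typical B (mu : probability X R) :
  attractor B -> {ae Prob mu, forall rho, typical B rho}.
Proof.
move=> attB.
have ae3 : {ae Prob mu, forall rho, forall x y, transition x y ->
    infinitely_often [set x] rho -> infinitely_often [set y] rho}.
  apply: ae_forall_state => x; apply: ae_forall_state => y.
  have [xy|/negP Nxy] := boolP (transition x y); last exact: aeW.
  by apply: (sub_ae (ae_infinitely_often_transition xy mu)).
have ae12 := negligibleU (ae_transition mu)
  (ae_infinitely_often_attractor mu attB).
apply: negligibleS (negligibleU ae12 ae3) => rho /= Nt.
apply: contrapT => /not_orP[/not_orP[/contrapT t1 /contrapT t2] /contrapT t3].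
exact: Nt.
Qed.

Section typical.
Variables (B : set X) (rho : infinite_path X).
Hypothesis rho_typical : typical B rho.

Lemma typical_reaches i j : (i <= j)%N -> reaches (rho i) (rho j).
Proof.
case: rho_typical => pos _ _ /subnK <-; elim: (j - i)%N => [|n IH].
  exact: reaches_refl.
exact: reaches_trans IH (reaches_transition (pos _)).
Qed.

Lemma infinitely_often_reaches x y : reaches x y ->
  infinitely_often [set x] rho -> infinitely_often [set y] rho.
Proof.
case: rho_typical => _ _ io [p [xp <-]].
elim: p x xp => [//|z p IH] x /= /andP[xz zp] iox.
exact: IH zp (io _ _ xz iox).
Qed.

Lemma typical_recurrent : finite_set B ->
  exists2 x, B x & infinitely_often [set x] rho.
Proof. by case: rho_typical => _ io _ fB; exact: infinitely_often_finite. Qed.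

Lemma infinitely_often_reaches_both x y : infinitely_often [set x] rho ->
  infinitely_often [set y] rho -> reaches x y.
Proof.
move=> iox ioy; have [i [_ <-]] := iox 0%N; have [j [ij <-]] := ioy i.
exact: typical_reaches.
Qed.

End typical.

End typical_paths.

(** * Muller acceptance and visits to good components *)

Section muller_acceptance.
Context (R : realType) (T : markov_chain R) (M : dma (mc_AP T)).
Local Notation X := (product_chain T M).
Variable B : set X.
Hypothesis fB : finite_set B.
Implicit Types (C : set X) (rho : infinite_path X).

Lemma inf_statesP rho (q : dma_state M) :
  q \in inf_states rho <->
  infinitely_often [set z : X | z.2 = q :> dma_state M] rho.
Proof.
rewrite inE; split=> [/asboolP H n|H]; last apply/asboolP => n.
  by have [m nm mq] := H n; exists m.
by have [m [nm mq]] := H n; exists m.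
Qed.

(** As the automaton is finite, the event is a finite Boolean combination of [infinitely_often]
    events. *)
Lemma measurable_inf_in (F : {set {set dma_state M}}) :
  measurable (@inf_in R T M F).
Proof.
rewrite (_ : inf_in F =
    \bigcup_(F0 in [set F0 | F0 \in F]) \bigcap_(q in setT)
      [set rho | q \in inf_states rho = (q \in F0)]); last first.
  apply/seteqP; split=> rho.
    by move=> rhoF; exists (inf_states rho).
  by move=> [F0 F0F H]; rewrite /inf_in /= (_ : inf_states rho = F0)//;
    apply/setP => q; exact: H.
apply: fin_bigcup_measurable; first exact: finite_finset.
move=> F0 _; apply: fin_bigcap_measurable; first exact: finite_finset.
move=> q _; have mq := @measurable_infinitely_often _ X
  [set z : X | z.2 = q :> dma_state M].
case: (q \in F0).
  rewrite (_ : [set _ | _] =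
    infinitely_often [set z : X | z.2 = q :> dma_state M])//.
  by apply/seteqP; split=> rho /=; rewrite -inf_statesP.
rewrite (_ : [set _ | _] =
  ~` infinitely_often [set z : X | z.2 = q :> dma_state M]).
  exact: measurableC.
apply/seteqP; split=> rho /= qrho; first by move/inf_statesP; rewrite qrho.
by apply/negbTE/negP => /inf_statesP.
Qed.

Lemma typical_inf_in F rho : typical B rho ->
  inf_in F rho <-> exists2 C, good F B C & visits C rho.
Proof.
move=> rhoB; have [x Bx iox] := typical_recurrent rhoB fB.
split=> [infF|[C [[sccC bC] [F0 F0F [CF0 F0C]]] [i Ci]]].
  have [i [_ ix]] := iox 0%N.
  (* The witness is the component of the recurrent state [x]; all its states recur too. *)
  pose C : set X := [set y | [/\ B y, walk B (@reaches R X) x y &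
                              walk B (@reaches R X) y x]].
  have ioC y : C y -> infinitely_often [set y] rho.
    by move=> [_ /walk_reaches xy _]; exact: (infinitely_often_reaches rhoB xy).
  have Cx : C x by split=> //; exact: Relation_Operators.rt_refl.
  exists C; last by exists i; rewrite ix.
  split.
    split; first by exists x.
    (* The component is bottom: a state of [B] reached from it recurs, hence leads back to [x]. *)
    move=> y z Cy Bz yz; have ioz := infinitely_often_reaches rhoB yz (ioC y Cy).
    by split=> //; apply: reaches_walk => //;
      exact: (infinitely_often_reaches_both rhoB).
  exists (inf_states rho); first exact: infF.
  split=> [y z Cy yz|q /inf_statesP qrho].
    apply/inf_statesP => n.
    have [m [nm mz]] := infinitely_often_reaches rhoB yz (ioC y Cy) n.
    by exists m; rewrite nm; split=> //=; rewrite mz.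
  (* A visit to [q] after time [i], when the path is at [x], shows that [q] is reachable from
     [C]. *)
  have [m [im mq]] := qrho i; exists (rho m).1, x; split=> //.
  have := typical_reaches rhoB im; rewrite ix (_ : rho m = ((rho m).1, q))//.
  by rewrite -mq; case: (rho m).
(* Conversely, [x] occurs after the visit to [C], and [C] cannot be left within [B], so [x] lies in
   [C]. *)
have [j [ij jx]] := iox i.
have Cx : C x.
  by apply: bC Ci Bx _; rewrite -jx; exact: typical_reaches rhoB _ _ ij.
rewrite /inf_in /= (_ : inf_states rho = F0)//; apply/setP => q.
apply/idP/idP => [/inf_statesP qrho|/F0C[s [y [Cy ys]]]].
  have [m [im <-]] := qrho i.
  exact: CF0 Ci (typical_reaches rhoB im).
(* Within the component [x] reaches [y], hence [(s, q)], which then recurs along with [x]. *)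
have xs : reaches x (s, q).
  apply: reaches_trans ys; have := Cy.
  by rewrite (is_sccE sccC Cx) => -[].
apply/inf_statesP => n.
have [m [nm mq]] := infinitely_often_reaches rhoB xs iox n.
by exists m; rewrite nm; split=> //=; rewrite mq.
Qed.

(** Both components contain the recurrent state [x], since neither can be left within [B]. *)
Lemma visited_bscc_unique rho C1 C2 : typical B rho ->
  is_bscc B (@reaches R X) C1 -> is_bscc B (@reaches R X) C2 ->
  visits C1 rho -> visits C2 rho -> C1 = C2.
Proof.
move=> rhoB [scc1 b1] [scc2 b2] [i Ci] [j Cj].
have [x Bx iox] := typical_recurrent rhoB fB.
have Cx C k : (forall y z, C y -> B z -> reaches y z -> C z) -> C (rho k) -> C x.
  move=> bC Ck; have [l [kl lx]] := iox k.
  by apply: bC Ck Bx _; rewrite -lx; exact: typical_reaches rhoB _ _ kl.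
by rewrite (is_sccE scc1 (Cx _ _ b1 Ci)) (is_sccE scc2 (Cx _ _ b2 Cj)).
Qed.

(** Every component is the class of some state of the finite set [B]. *)
Lemma finite_good F : finite_set (good F B).
Proof.
apply: sub_finite_set (finite_image (fun x => [set y |
  [/\ B y, walk B (@reaches R X) x y & walk B (@reaches R X) y x]]) fB).
by move=> C [[[x Bx ->] _] _]; exists x.
Qed.

End muller_acceptance.

Theorem theorem46 (R : realType) (T : markov_chain R) (M : dma (mc_AP T))
  (B : set (product_chain T M)) :
  (exists A : set T, finite_set A /\ attractor A) ->
  finite_set B -> attractor B ->
  forall mu : probability T R,
    Prob (product_init mu) (inf_in (dma_accept M)) =
    \sum_(C \in good (dma_accept M) B)
      Prob (product_init mu) (visits C).
Proof.
move=> _ fB attB mu; set P := Prob _.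
have aeB := ae_typical (product_init mu) attB.
(* Off the measurable null set [N] all paths are typical; cutting events down to its complement
   turns almost sure statements into set identities. *)
have [N [mN PN subN]] := aeB.
have typN rho : (~` N) rho -> typical B rho.
  by move=> Nrho; apply: contrapT => /subN.
have mN' : measurable (~` N) by exact: measurableC.
have aeN : {ae P, forall rho, (~` N) rho} by exact: prob0_ae.
have mI (E : set (infinite_path (product_chain T M))) :
    measurable E -> measurable (E `&` ~` N) by move=> mE; exact: measurableI.
have PI (E : set (infinite_path (product_chain T M))) :
    measurable E -> P E = P (E `&` ~` N).
  move=> mE; apply: (ae_eq_prob mE (mI _ mE)).
  by apply: (sub_ae aeN) => rho Nrho; split=> [|[]].
rewrite PI; last exact: measurable_inf_in.
rewrite (_ : _ `&` _ =
    \bigcup_(C in good (dma_accept M) B) (visits C `&` ~` N)).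
  rewrite measure_fin_bigcup//.
  - by apply: eq_fsbigr => C _; apply/esym/PI; exact: measurable_visits.
  - exact: finite_good.
  (* Disjointness: a typical path in both events forces the components to be equal. *)
  - move=> C1 C2 [g1 _] [g2 _] [rho [[v1 Nrho] [v2 _]]].
    exact: (visited_bscc_unique fB (typN _ Nrho) g1 g2).
  - by move=> C _; apply: mI; exact: measurable_visits.
apply/seteqP; split=> rho.
  move=> [infF Nrho]; have [C gC vC] := (typical_inf_in fB _ (typN _ Nrho)).1 infF.
  by exists C.
move=> [C gC [vC Nrho]]; split=> //.
by apply/(typical_inf_in fB _ (typN _ Nrho)); exists C.
Qed.
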